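(* Algorithm 2 is a factor-$3$ approximation algorithm for $1|(a_j,L,b_j)|\sum C_j$. That is, Algorithm 2 runs in polynomial time, and for every instance with $L_j=L$ for all jobs $j$ and arbitrary processing times $a_j,b_j$, it outputs a feasible schedule whose sum of completion times is at most $3$ times the minimum sum of completion times over all feasible schedules.
   Context: Coupled task scheduling on a single machine: each job $j\in\{1,\dots,n\}$ has a first task of processing time $a_j>0$, a second task of processing time $b_j>0$, and a delay time $L_j\ge 0$. The two tasks of job $j$ are also denoted $a_j$ and $b_j$. A feasible schedule assigns a starting time $S_j\ge 0$ to each job $j$; the first task occupies $[S_j,S_j+a_j]$, the second task occupies $[S_j+a_j+L_j,\,S_j+a_j+L_j+b_j]$ (the delay is exact, no preemption), and no two of the $2n$ tasks overlap (their intervals have disjoint interiors). Other tasks may be processed during the delay of a job. The completion time of $j$ is $C_j=S_j+a_j+L_j+b_j$, and the objective is to minimize $\sum_{j=1}^n C_j$. Algorithm 2. Input: an instance with $L_j=L$ for all $j$. Step 1: sort the jobs in non-decreasing order of $a_j+b_j$ and re-index them in this order. Step 2: schedule $a_1$ from time $0$ and $b_1$ from time $a_1+L$. Let $s:=1$, $j_s:=1$. Step 3: for $j=2,\dots,n$: (i) if it is possible to start $a_j$ immediately after $a_{j-1}$ (at the completion of $a_{j-1}$) with neither $a_j$ nor $b_j$ intersecting any task already scheduled, then do so and go to the next job; (ii) otherwise, if it is possible to start $b_j$ right after $b_{j-1}$ (at the completion of $b_{j-1}$) with neither $a_j$ nor $b_j$ intersecting any task already scheduled, then do so and go to the next job;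 (iii) otherwise start $a_j$ immediately after $b_{j-1}$, and let $s:=s+1$, $j_s:=j$. In all cases the other task of $j$ is placed according to the exact delay $L$. *)

(* Defs.v *)
From HB Require Import structures.
From mathcomp Require Import all_boot all_order all_algebra.
Set Implicit Arguments.
Unset Strict Implicit.
Unset Printing Implicit Defensive.
Import Order.TTheory GRing.Theory Num.Theory.
Local Open Scope ring_scope.

Section CoupledTasks.
Variables (R : realFieldType) (n : nat).
Implicit Types (a b l S : 'I_n -> R).

(* The tasks are indexed by 'I_n * bool: (j, false) is the first task of job j
   and (j, true) the second one. *)
Definition task_start a l S (u : 'I_n * bool) : R :=
  if u.2 then S u.1 + a u.1 + l u.1 else S u.1.

Definition task_length a b (u : 'I_n * bool) : R :=
  if u.2 then b u.1 else a u.1.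

Definition task_interior a b l S u : interval R :=
  `]task_start a l S u, task_start a l S u + task_length a b u[.

Definition feasible a b l S : Prop :=
  (forall j, 0 <= S j) /\
  (forall u v, u != v -> forall t : R,
     ~~ ((t \in task_interior a b l S u) && (t \in task_interior a b l S v))).

Definition completion a b l S (j : 'I_n) : R := S j + a j + l j + b j.

Definition total_completion a b l S : R := \sum_j completion a b l S j.

End CoupledTasks.

(* The end-point test by which the algorithm decides that [x, x + p] and
   [y, y + q] have disjoint interiors; see clearP. *)
Definition clear (R : realFieldType) (x p y q : R) : bool :=
  (x + p <= y) || (y + q <= x).

Lemma clearP (R : realFieldType) (x p y q : R) : 0 < p -> 0 < q ->
  reflect (forall t : R, ~~ ((t \in `]x, (x + p)[) && (t \in `]y, (y + q)[)))
          (clear x p y q).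
Proof.
move=> p0 q0; apply: (iffP orP) => [xy t|disj].
  rewrite !in_itv /=; apply/negP => /andP[/andP[xt tp] /andP[yt tq]].
  by case: xy => [/(lt_le_trans tp)/lt_trans/(_ yt)
                 |/(lt_le_trans tq)/lt_trans/(_ xt)]; rewrite ltxx.
case: (lerP (x + p) y) => [|yxp]; first by left.
case: (lerP (y + q) x) => [|xyq]; first by right.
pose M := Num.max x y; pose m := Num.min (x + p) (y + q).
have Mm : M < m by rewrite gt_max !lt_min !ltrDl p0 q0 xyq yxp.
have [Mh hm] := midf_lt Mm.
move: (disj ((M + m) / 2)); rewrite !in_itv /=.
move: Mh hm; rewrite gt_max lt_min => /andP[-> ->] /andP[-> ->] //.
Qed.

Section Algorithm2.
Variables (R : realFieldType) (n : nat) (a b : 'I_n -> R) (L : R).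
Implicit Types (done order : seq 'I_n) (S : 'I_n -> R).

(* Ties may be broken arbitrarily: every sorted enumeration is admissible. *)
Definition sorted_order order : bool :=
  perm_eq order (enum 'I_n) &&
  sorted (fun i j => a i + b i <= a j + b j) order.

(* Neither task of job j, started at time s, meets a task of a job in done. *)
Definition fits done S (j : 'I_n) (s : R) : bool :=
  all (fun i => [&& clear s (a j) (S i) (a i),
                    clear s (a j) (S i + a i + L) (b i),
                    clear (s + a j + L) (b j) (S i) (a i)
                  & clear (s + a j + L) (b j) (S i + a i + L) (b i)]) done.

(* done lists the scheduled jobs, the last scheduled one first. *)
Definition start_time done S (j : 'I_n) : R :=
  if done isn't i :: _ then 0 else
  let after_first := S i + a i in
  let after_second := S i + a i + L + b i in
  if fits done S j after_first then after_first
  else if fits done S j (after_second - L - a j) then after_second - L - a j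
  else after_second.

Definition alg2_step (st : seq 'I_n * ('I_n -> R)) (j : 'I_n) :
    seq 'I_n * ('I_n -> R) :=
  (j :: st.1, fun i => if i == j then start_time st.1 st.2 j else st.2 i).

(* The pseudo-code also counts blocks of jobs (s, j_s); these counters do not
   influence the starting times and are not kept. *)
Definition alg2 order : 'I_n -> R :=
  (foldl alg2_step ([::], fun=> 0) order).2.

End Algorithm2.

(* A random-access machine. It has arrays of naturals (indices) and arrays of rationals, both
   named by naturals; a scalar variable is cell 0 of an array. Its only
   operations are addition, subtraction and comparison. Evaluating a node of an
   expression costs 1 plus the bit size of its value, and every instruction and
   test costs 1 more, so that cost and Turing-machine time are polynomially
   related. *)

Definition nbits (m : nat) : nat := (trunc_log 2 m).+1.
Definition qbits (x : rat) : nat := nbits `|numq x| + nbits `|denq x|.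

Inductive iexp :=
  | ICst of nat
  | IGet of nat & iexp
  | IAdd of iexp & iexp
  | ISub of iexp & iexp.

Inductive qexp :=
  | QCst of nat
  | QGet of nat & iexp
  | QAdd of qexp & qexp
  | QSub of qexp & qexp.

Inductive bexp :=
  | BLt of iexp & iexp
  | BLe of qexp & qexp
  | BNot of bexp
  | BAnd of bexp & bexp
  | BOr of bexp & bexp.

Inductive cmd :=
  | Skip
  | ISet of nat & iexp & iexp
  | QSet of nat & iexp & qexp
  | Seq of cmd & cmd
  | If of bexp & cmd & cmd
  | While of bexp & cmd.

Record memory := Memory {
  imem : nat -> nat -> nat;
  qmem : nat -> nat -> rat }.

Definition upd (T : Type) (m : nat -> nat -> T) x i v : nat -> nat -> T :=
  fun y k => if (y == x) && (k == i) then v else m y k.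

Fixpoint ieval (m : memory) e : nat :=
  match e with
  | ICst c => c
  | IGet x f => imem m x (ieval m f)
  | IAdd f g => ieval m f + ieval m g
  | ISub f g => ieval m f - ieval m g
  end%N.

Fixpoint qeval (m : memory) e : rat :=
  match e with
  | QCst c => c%:R
  | QGet x f => qmem m x (ieval m f)
  | QAdd f g => qeval m f + qeval m g
  | QSub f g => qeval m f - qeval m g
  end.

Fixpoint beval (m : memory) e : bool :=
  match e with
  | BLt f g => (ieval m f < ieval m g)%N
  | BLe f g => qeval m f <= qeval m g
  | BNot f => ~~ beval m f
  | BAnd f g => beval m f && beval m g
  | BOr f g => beval m f || beval m g
  end.

Fixpoint icost (m : memory) e : nat :=
  (1 + nbits (ieval m e) +
  match e with
  | ICst _ => 0
  | IGet _ f => icost m f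
  | IAdd f g | ISub f g => icost m f + icost m g
  end)%N.

Fixpoint qcost (m : memory) e : nat :=
  (1 + qbits (qeval m e) +
  match e with
  | QCst _ => 0
  | QGet _ f => icost m f
  | QAdd f g | QSub f g => qcost m f + qcost m g
  end)%N.

Fixpoint bcost (m : memory) e : nat :=
  (1 +
  match e with
  | BLt f g => icost m f + icost m g
  | BLe f g => qcost m f + qcost m g
  | BNot f => bcost m f
  | BAnd f g | BOr f g => bcost m f + bcost m g
  end)%N.

(* exec c m t m': from memory m the command c halts, with cost t, in m'. *)
Inductive exec : cmd -> memory -> nat -> memory -> Prop :=
  | ExecSkip m : exec Skip m 1 m
  | ExecISet m x e f :
      exec (ISet x e f) m (1 + icost m e + icost m f)
        (Memory (upd (imem m) x (ieval m e) (ieval m f)) (qmem m))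
  | ExecQSet m x e f :
      exec (QSet x e f) m (1 + icost m e + qcost m f)
        (Memory (imem m) (upd (qmem m) x (ieval m e) (qeval m f)))
  | ExecSeq c d m t m' t' m'' :
      exec c m t m' -> exec d m' t' m'' -> exec (Seq c d) m (1 + t + t') m''
  | ExecIf e c d m t m' :
      exec (if beval m e then c else d) m t m' ->
      exec (If e c d) m (1 + bcost m e + t) m'
  | ExecWhileStop e c m :
      ~~ beval m e -> exec (While e c) m (1 + bcost m e) m
  | ExecWhileStep e c m t m' t' m'' :
      beval m e -> exec c m t m' -> exec (While e c) m' t' m'' ->
      exec (While e c) m (1 + bcost m e + t + t') m''.

Declare Scope iexp_scope.
Declare Scope qexp_scope.
Declare Scope bexp_scope.
Declare Scope cmd_scope.
Delimit Scope iexp_scope with iexp.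
Delimit Scope qexp_scope with qexp.
Delimit Scope bexp_scope with bexp.
Delimit Scope cmd_scope with cmd.
Bind Scope iexp_scope with iexp.
Bind Scope qexp_scope with qexp.
Bind Scope bexp_scope with bexp.
Bind Scope cmd_scope with cmd.

Arguments IGet _%_N _%_iexp.
Arguments IAdd _%_iexp _%_iexp.
Arguments ISub _%_iexp _%_iexp.
Arguments QGet _%_N _%_iexp.
Arguments QAdd _%_qexp _%_qexp.
Arguments QSub _%_qexp _%_qexp.
Arguments BLt _%_iexp _%_iexp.
Arguments BLe _%_qexp _%_qexp.
Arguments BNot _%_bexp.
Arguments BAnd _%_bexp _%_bexp.
Arguments BOr _%_bexp _%_bexp.
Arguments ISet _%_N _%_iexp _%_iexp.
Arguments QSet _%_N _%_iexp _%_qexp.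
Arguments Seq _%_cmd _%_cmd.
Arguments If _%_bexp _%_cmd _%_cmd.
Arguments While _%_bexp _%_cmd.

Module ProgNotations.
Coercion ICst : nat >-> iexp.
Coercion QCst : nat >-> qexp.
Notation "e + f" := (IAdd e f) : iexp_scope.
Notation "e - f" := (ISub e f) : iexp_scope.
Notation "e + f" := (QAdd e f) : qexp_scope.
Notation "e - f" := (QSub e f) : qexp_scope.
Notation "e < f" := (BLt e f) : bexp_scope.
Notation "e <= f" := (BLe e f) : bexp_scope.
Notation "e && f" := (BAnd e f) : bexp_scope.
Notation "e || f" := (BOr e f) : bexp_scope.
Notation "~~ e" := (BNot e) : bexp_scope.
Notation "c ;; d" := (Seq c d)
  (at level 90, right associativity, format "c  ;; '//' d") : cmd_scope.
End ProgNotations.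

(* Array names: x* for arrays of naturals, y* for arrays of rationals. *)
Definition xn := 0%N.
Definition xord := 1%N.
Definition xi := 2%N.
Definition xj := 3%N.
Definition xk := 4%N.
Definition xtmp := 5%N.
Definition xok := 6%N.

Definition yL := 0%N.
Definition ya := 1%N.
Definition yb := 2%N.
Definition yS := 3%N.
Definition ys := 4%N.

Section Program.
Import ProgNotations.
Local Open Scope nat_scope.

Local Notation n_ := (IGet xn 0).
Local Notation ord_ := (IGet xord).
Local Notation i_ := (IGet xi 0).
Local Notation j_ := (IGet xj 0).
Local Notation k_ := (IGet xk 0).
Local Notation tmp_ := (IGet xtmp 0).
Local Notation ok_ := (IGet xok 0).
Local Notation L_ := (QGet yL 0).
Local Notation a_ := (QGet ya).
Local Notation b_ := (QGet yb).
Local Notation S_ := (QGet yS).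
Local Notation s_ := (QGet ys 0).

Definition clear_exp (x p y q : qexp) : bexp := (x + p <= y) || (y + q <= x).

(* Insertion sort of the array ord of job names. *)
Definition sort_prog : cmd :=
  (ISet xi 0 0 ;;
   While (i_ < n_) (
     ISet xord i_ i_ ;;
     ISet xk 0 i_ ;;
     While ((0 < k_) &&
            ~~ (a_ (ord_ (k_ - 1)) + b_ (ord_ (k_ - 1))
                <= a_ (ord_ k_) + b_ (ord_ k_))) (
       ISet xtmp 0 (ord_ k_) ;;
       ISet xord k_ (ord_ (k_ - 1)) ;;
       ISet xord (k_ - 1) tmp_ ;;
       ISet xk 0 (k_ - 1)) ;;
     ISet xi 0 (i_ + 1)))%cmd.

(* Sets ok to 1 if the j-th job in the order ord can start at time s given the
   jobs before it, and to 0 otherwise. *)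
Definition fits_prog : cmd :=
  let cur := ord_ j_ in
  let r := ord_ k_ in
  (ISet xok 0 1 ;;
   ISet xk 0 0 ;;
   While (k_ < j_) (
     If (clear_exp s_ (a_ cur) (S_ r) (a_ r) &&
         clear_exp s_ (a_ cur) (S_ r + a_ r + L_) (b_ r) &&
         clear_exp (s_ + a_ cur + L_) (b_ cur) (S_ r) (a_ r) &&
         clear_exp (s_ + a_ cur + L_) (b_ cur) (S_ r + a_ r + L_) (b_ r))
       Skip
       (ISet xok 0 0) ;;
     ISet xk 0 (k_ + 1)))%cmd.

Definition alg2_prog : cmd :=
  let cur := ord_ j_ in
  let prev := ord_ (j_ - 1) in
  (sort_prog ;;
   If (0 < n_) (QSet yS (ord_ 0) 0) Skip ;;
   ISet xj 0 1 ;;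
   While (j_ < n_) (
     QSet ys 0 (S_ prev + a_ prev) ;;
     fits_prog ;;
     If (0 < ok_) Skip
       (QSet ys 0 (S_ prev + a_ prev + L_ + b_ prev - L_ - a_ cur) ;;
        fits_prog ;;
        If (0 < ok_) Skip
          (QSet ys 0 (S_ prev + a_ prev + L_ + b_ prev))) ;;
     QSet yS cur s_ ;;
     ISet xj 0 (j_ + 1)))%cmd.

End Program.

Section Encoding.
Variables (n : nat) (a b : 'I_n -> rat) (L : rat).

(* Cells outside the input are 0. *)
Definition input : memory :=
  let cells (f : 'I_n -> rat) (k : nat) : rat := oapp f 0 (insub k) in
  Memory
    (fun x k => if (x == xn) && (k == 0) then n else 0)%N
    (fun y k => if y == yL then (if k == 0%N then L else 0)
                else if y == ya then cells a k
                else if y == yb then cells b k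
                else 0).

Definition input_size : nat :=
  (nbits n + qbits L + \sum_(j < n) (qbits (a j) + qbits (b j)))%N.

Definition output (m : memory) (j : 'I_n) : rat := qmem m yS j.

End Encoding.

(* Main.v *)
Require Import Defs.
From mathcomp Require Import all_boot all_order all_algebra.
From mathcomp Require Import lra zify.
Set Implicit Arguments.
Unset Strict Implicit.
Unset Printing Implicit Defensive.
Import Order.TTheory GRing.Theory Num.Theory.

(* Write P_j for the total processing time of the first j jobs of the order.
   Appending job j to the current block raises the last completion time by at
   most a_j + b_j; opening a new block costs L more. Job j fails to join the
   block j_s, ..., j - 1 only if the sum of a_i + b_(i-1) over j_s < i <= j is
   at least L, and these tasks are disjoint for different blocks, so the
   failures up to j cost at most P_j: hence C_j <= 2 P_j + L. In an arbitrary
   schedule the sum of the completion times is at least n L; it is also at least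
   the sum of the P_j, because the machine processes all jobs completed by time
   C before C, so each pair of jobs contributes at least the smaller of its two
   processing times.

   For the running time, all the rationals in memory are multiples of 1 / D,
   where D is the product of the denominators of the input, and their numerators
   are bounded by 2 ^ O(N), so that each step costs O(N) for an input of size
   N. *)

(** * Running time *)

Local Open Scope nat_scope.

Lemma nbits_leq m p : m <= p -> nbits m <= nbits p.
Proof. by move=> mp; rewrite /nbits ltnS leq_trunc_log. Qed.

Lemma nbits_exp2 m k : m <= 2 ^ k -> nbits m <= k.+1.
Proof. by move=> /nbits_leq; rewrite {2}/nbits trunc_expnK. Qed.

Lemma ltn_nbits m : m < 2 ^ nbits m.
Proof. exact: trunc_log_ltn. Qed.

(** * Bit sizes of values and costs of commands *)

Section Cost.
Variables (N I D K : nat).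

(** The weight bounds two quantities at once: the number of nodes of an expression and, multiplied
    by a bound on the memory cells, its value. *)
Fixpoint iweight (e : iexp) : nat :=
  match e with
  | ICst c => c.+1
  | IGet _ f => (iweight f).+1
  | IAdd f g | ISub f g => (iweight f + iweight g).+1
  end.

Fixpoint qweight (e : qexp) : nat :=
  match e with
  | QCst c => c.+1
  | QGet _ f => (iweight f).+1
  | QAdd f g | QSub f g => (qweight f + qweight g).+1
  end.

Fixpoint bweight (e : bexp) : nat :=
  match e with
  | BLt f g => (iweight f + iweight g).+1
  | BLe f g => (qweight f + qweight g).+1
  | BNot f => (bweight f).+1
  | BAnd f g | BOr f g => (bweight f + bweight g).+1
  end.

(** Over a fixed denominator [D], numerators merely add up under addition and subtraction, whereas
    reduced denominators would need a new estimate at each operation. *)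
Definition smallq (M : nat) (x : rat) : Prop :=
  exists2 z : int, (x * D%:R = z%:~R)%R & `|z|%N <= M.

Definition good (m : memory) : Prop :=
  (forall x i, imem m x i <= I) /\ (forall y i, smallq K (qmem m y i)).

(** Exceeds the weight of every expression of the program; being 2 ^ 9, it adds 9 bits to the size
    bounds. *)
Definition max_weight := 512.

(** Bounds the charge for one node of an expression: the successor is the unit cost, and the sum
    covers naturals and rationals alike. *)
Definition value_bits :=
  (nbits (max_weight * I) + nbits (max_weight * K) + nbits D).+1.

Definition step_cost := max_weight * value_bits.

Lemma smallq_leq M M' x : M <= M' -> smallq M x -> smallq M' x.
Proof. by move=> MM' [z xz zM]; exists z => //; apply: leq_trans MM'. Qed.

Lemma smallq_nat c : smallq (c * D) c%:R.
Proof. by exists (Posz (c * D)); rewrite // -natrM. Qed.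

Lemma smallqD M M' x y : smallq M x -> smallq M' y -> smallq (M + M') (x + y).
Proof.
move=> [z xz zM] [t yt tM]; exists (z + t)%R;
  first by rewrite mulrDl xz yt rmorphD.
by lia.
Qed.

Lemma smallqB M M' x y : smallq M x -> smallq M' y -> smallq (M + M') (x - y).
Proof.
move=> [z xz zM] [t yt tM]; exists (z - t)%R;
  first by rewrite mulrBl xz yt rmorphB.
by lia.
Qed.

Lemma good_iset m x i v : good m -> v <= I ->
  good (Memory (upd (imem m) x i v) (qmem m)).
Proof.
by move=> [mI mK] vI; split=> // y k; rewrite /= /upd; case: ifP.
Qed.

Lemma good_qset m x i v : good m -> smallq K v ->
  good (Memory (imem m) (upd (qmem m) x i v)).
Proof.
by move=> [mI mK] vI; split=> // y k; rewrite /= /upd; case: ifP.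
Qed.

(* Bounds the number of instructions and tests executed by [c] when each of its
   loops makes at most [N] iterations. *)
Fixpoint steps (c : cmd) : nat :=
  match c with
  | Skip | ISet _ _ _ | QSet _ _ _ => 1
  | Seq c d => (steps c + steps d).+1
  | If _ c d => (steps c + steps d).+1
  | While _ c => (N * (steps c).+1).+1
  end.

(** Total correctness with a cost bound read off the syntax of [c], so that the verification of the
    program deals with values and loop variants but computes no cost. *)
Definition halts (c : cmd) (m : memory) (Q : memory -> Prop) : Prop :=
  exists t m', [/\ exec c m t m', t <= steps c * step_cost & Q m'].

Lemma step_cost_gt0 : 0 < step_cost.
Proof. by rewrite muln_gt0. Qed.

Lemma halts_imp c m (Q Q' : memory -> Prop) :
  (forall m', Q m' -> Q' m') -> halts c m Q -> halts c m Q'.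
Proof. by move=> QQ' [t [m' [ex tk Qm]]]; exists t, m'; split; auto. Qed.

Lemma halts_skip m (Q : memory -> Prop) : Q m -> halts Skip m Q.
Proof.
move=> Qm; exists 1, m; split=> //.
exact: ExecSkip.
Qed.

Lemma halts_seq c d m (Q : memory -> Prop) :
  halts c m (fun m' => halts d m' Q) -> halts (Seq c d) m Q.
Proof.
move=> [t [m' [ex1 tc [t' [m'' [ex2 td Qm]]]]]].
do 2 eexists; split; [exact: ExecSeq ex1 ex2| |exact: Qm].
by have := step_cost_gt0; rewrite /= mulSn mulnDl; lia.
Qed.

Hypotheses (I_gt0 : 0 < I) (D_gt0 : 0 < D) (D_le_K : D <= K).

(** In lowest terms the denominator of [x] divides [D], and its numerator divides [z] with the same
    quotient [q], so neither is larger than the number it divides. *)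
Lemma smallq_bits M x : smallq M x -> qbits x <= nbits M + nbits D.
Proof.
move=> [z xz zM]; rewrite /qbits.
have den0 := denq_neq0 x.
have numD : (numq x * Posz D = z * denq x)%R.
  apply/eqP; rewrite -(eqr_int rat) !rmorphM /= -xz -[in X in (_ == X * _ *
    _)%R](divq_num_den x).
  by rewrite mulrAC divfK ?intr_eq0.
have {numD} numD : `|numq x| * D = `|z| * `|denq x|.
  by rewrite -[D]/(`|Posz D|) -!abszM numD.
have /dvdnP[q Dq] : `|denq x| %| D.
  rewrite -(@Gauss_dvdr _ `|numq x|) 1?coprime_sym ?coprime_num_den //.
  by rewrite numD dvdn_mull.
have den_gt0 : 0 < `|denq x| by rewrite absz_gt0.
have q0 : 0 < q by move: D_gt0; rewrite Dq muln_gt0 => /andP[].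
have zq : `|z| = `|numq x| * q.
  by apply/eqP; rewrite -(eqn_pmul2r den_gt0) -numD Dq mulnA.
apply: leq_add; apply: nbits_leq.
  by apply: leq_trans zM; rewrite zq leq_pmulr.
by rewrite Dq leq_pmull.
Qed.

Lemma ieval_leq m e : good m -> ieval m e <= iweight e * I.
Proof.
move=> [mI _]; elim: e => [c|x f _|f IHf g IHg|f IHf g IHg] /=.
- by rewrite mulSn; apply: leq_trans (leq_addl _ _); rewrite leq_pmulr.
- by rewrite mulSn; apply: leq_trans (mI _ _) (leq_addr _ _).
- by rewrite mulSn mulnDl; apply: leq_trans (leq_addl _ _); exact: leq_add.
- rewrite mulSn mulnDl; apply: leq_trans (leq_subr _ _) _.
  by apply: leq_trans IHf _; rewrite addnCA leq_addr.
Qed.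

Lemma qeval_small m e : good m -> smallq (qweight e * K) (qeval m e).
Proof.
move=> [_ mK]; elim: e => [c|x f|f IHf g IHg|f IHf g IHg] /=.
- apply: smallq_leq (smallq_nat _).
  by apply: leq_mul.
- by apply: smallq_leq (mK _ _); rewrite mulSn leq_addr.
- by apply: smallq_leq (smallqD IHf IHg); rewrite mulSn mulnDl leq_addl.
- by apply: smallq_leq (smallqB IHf IHg); rewrite mulSn mulnDl leq_addl.
Qed.

Lemma icost_leq m e : good m -> iweight e <= max_weight ->
  icost m e <= iweight e * value_bits.
Proof.
move=> gm.
have bits f : iweight f <= max_weight -> 1 + nbits (ieval m f) <= value_bits.
  move=> fW; rewrite add1n ltnS -addnA; apply: leq_trans (leq_addr _ _).
  apply: nbits_leq; apply: leq_trans (ieval_leq f gm) _.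
  by rewrite leq_mul2r fW orbT.
elim: e => [c|x f IHf|f IHf g IHg|f IHf g IHg] W; have := bits _ W.
all: rewrite [icost _ _]/=; move: W; rewrite [iweight _]/= mulSn => W bits1.
- rewrite addn0; apply: leq_trans bits1 (leq_addr _ _).
- by apply: leq_add bits1 (IHf (ltnW W)).
- by rewrite mulnDl; apply: leq_add bits1 _; apply: leq_add;
    [apply: IHf|apply: IHg]; lia.
- by rewrite mulnDl; apply: leq_add bits1 _; apply: leq_add;
    [apply: IHf|apply: IHg]; lia.
Qed.

Lemma qcost_leq m e : good m -> qweight e <= max_weight ->
  qcost m e <= qweight e * value_bits.
Proof.
move=> gm.
have bits f : qweight f <= max_weight -> 1 + qbits (qeval m f) <= value_bits.
  move=> fW; rewrite add1n ltnS /value_bits -addnA.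
  apply: leq_trans (smallq_bits (qeval_small f gm)) _.
  apply: leq_trans (leq_addl _ _); rewrite leq_add2r; apply: nbits_leq.
  by rewrite leq_mul2r fW orbT.
elim: e => [c|x f|f IHf g IHg|f IHf g IHg] W; have := bits _ W.
all: rewrite [qcost _ _]/=; move: W; rewrite [qweight _]/= mulSn => W bits1.
- rewrite addn0; apply: leq_trans bits1 (leq_addr _ _).
- by apply: leq_add bits1 (icost_leq gm (ltnW W)).
- by rewrite mulnDl; apply: leq_add bits1 _; apply: leq_add;
    [apply: IHf|apply: IHg]; lia.
- by rewrite mulnDl; apply: leq_add bits1 _; apply: leq_add;
    [apply: IHf|apply: IHg]; lia.
Qed.

Lemma bcost_leq m e : good m -> bweight e <= max_weight ->
  bcost m e <= bweight e * value_bits.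
Proof.
move=> gm.
elim: e => [f g|f g|f IHf|f IHf g IHg|f IHf g IHg] W /=.
all: move: W; rewrite [bweight _]/= => W; rewrite mulSn.
all: apply: leq_add => //; rewrite ?mulnDl.
- by apply: leq_add; apply: icost_leq => //; lia.
- by apply: leq_add; apply: qcost_leq => //; lia.
- by apply: IHf; lia.
- by apply: leq_add; [apply: IHf|apply: IHg]; lia.
- by apply: leq_add; [apply: IHf|apply: IHg]; lia.
Qed.

Lemma weight_step_cost w : w < max_weight -> 1 + w * value_bits <= step_cost.
Proof.
move=> wW; apply: (@leq_trans (w.+1 * value_bits));
  first by rewrite mulSn leq_add2r.
by rewrite leq_mul2r wW orbT.
Qed.

Lemma halts_iset m x e f (Q : memory -> Prop) :
  good m -> iweight e + iweight f < max_weight ->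
  Q (Memory (upd (imem m) x (ieval m e) (ieval m f)) (qmem m)) ->
  halts (ISet x e f) m Q.
Proof.
move=> gm W Qm; do 2 eexists; split; [exact: ExecISet| |exact: Qm].
rewrite [steps _]/= mul1n; apply: leq_trans (weight_step_cost W).
by rewrite -addnA leq_add2l mulnDl leq_add ?icost_leq //; lia.
Qed.

Lemma halts_qset m x e f (Q : memory -> Prop) :
  good m -> iweight e + qweight f < max_weight ->
  Q (Memory (imem m) (upd (qmem m) x (ieval m e) (qeval m f))) ->
  halts (QSet x e f) m Q.
Proof.
move=> gm W Qm; do 2 eexists; split; [exact: ExecQSet| |exact: Qm].
rewrite [steps _]/= mul1n; apply: leq_trans (weight_step_cost W).
by rewrite -addnA leq_add2l mulnDl leq_add ?icost_leq ?qcost_leq //; lia.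
Qed.

Lemma halts_if e c d m (Q : memory -> Prop) :
  good m -> bweight e < max_weight ->
  (beval m e -> halts c m Q) -> (~~ beval m e -> halts d m Q) ->
  halts (If e c d) m Q.
Proof.
move=> gm W hc hd.
have := weight_step_cost W; have := bcost_leq gm (ltnW W).
have : halts (if beval m e then c else d) m Q by case: ifPn.
move=> [t [m' [ex tk Qm]]] ? ?.
do 2 eexists; split; [exact: ExecIf ex| |exact: Qm].
apply: leq_trans (_ : step_cost + t <= _); first by lia.
rewrite [steps _]/= mulSn mulnDl leq_add2l; apply: leq_trans tk _.
by case: ifP; rewrite ?leq_addr ?leq_addl.
Qed.

(** [P v] is the loop invariant indexed by the variant [v], which starts at most at [N] and
    decreases at each iteration. *)
Lemma halts_while e c (P : nat -> memory -> Prop) (Q : memory -> Prop) v m :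
  bweight e < max_weight -> v <= N ->
  (forall v m, P v m -> good m) ->
  (forall v m, P v m -> beval m e -> exists2 v', v' < v & halts c m (P v')) ->
  (forall v m, P v m -> ~~ beval m e -> Q m) ->
  P v m -> halts (While e c) m Q.
Proof.
move=> W vN Pgood Pbody PQ Pm.
(* Counting iterations by [v] instead of [N] makes the cost bound inductive. *)
suff [t [m' [ex tk Qm]]] : exists t m', [/\ exec (While e c) m t m',
    t <= (v * (steps c).+1).+1 * step_cost & Q m'].
  exists t, m'; split=> //; apply: leq_trans tk _.
  by rewrite leq_mul2r ltnS leq_mul2r vN !orbT.
have we := weight_step_cost W.
elim/ltn_ind: v m Pm {vN} => v IHv m Pm.
have be := bcost_leq (Pgood _ _ Pm) (ltnW W).
case: (boolP (beval m e)) => em; last first.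
  exists (1 + bcost m e), m; split; [exact: ExecWhileStop| |exact: PQ Pm em].
  by rewrite mulSn; lia.
have [v' v'v [t [m' [ex tk Pm']]]] := Pbody _ _ Pm em.
have [t' [m'' [ex' tk' Qm]]] := IHv _ v'v _ Pm'.
do 2 eexists; split; [exact: ExecWhileStep em ex ex'| |exact: Qm].
apply: leq_trans (_ : (v'.+1 * (steps c).+1).+1 * step_cost <= _); last first.
  by rewrite leq_mul2r ltnS leq_mul2r v'v !orbT.
rewrite -[in leqRHS]addn1 mulSn mulnDl mul1n mulnDl mulSn.
by rewrite mulSn in tk'; lia.
Qed.

End Cost.

(** * Permutations stored in arrays *)

Definition perm_upto (o : nat -> nat) (i : nat) : Prop :=
  (forall r, r < i -> o r < i) /\
  (forall u w, u < i -> w < i -> o u = o w -> u = w).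

Definition swap_pred (o : nat -> nat) (k r : nat) : nat :=
  if r == k - 1 then o k else if r == k then o (k - 1) else o r.

Lemma perm_upto_swap o o' i k : 0 < k < i -> o' =1 swap_pred o k ->
  perm_upto o i -> perm_upto o' i.
Proof.
move=> ki oo' [oi oinj]; split=> [r ri|u w ui wi].
  by rewrite oo' /swap_pred; do 2?[case: eqP => ? //=]; apply: oi; lia.
have swapE r : r < i -> exists2 r', r' < i & o' r = o r' /\
    r' = if r == k - 1 then k else if r == k then k - 1 else r.
  move=> ri; rewrite oo' /swap_pred; do 2?[case: eqP => ? /=].
  - by exists k => //; lia.
  - by exists (k - 1) => //; lia.
  - by exists r.
have [u' u'i [-> u'E]] := swapE u ui.
have [w' w'i [-> w'E]] := swapE w wi.
move=> /(oinj _ _ u'i w'i); rewrite u'E w'E.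
by do 4?[case: eqP => ? //=]; lia.
Qed.

Lemma perm_upto_last o o' i : o' =1 (fun r => if r == i then i else o r) ->
  perm_upto o i -> perm_upto o' i.+1.
Proof.
move=> oo' [oi oinj]; split=> [r ri|u w ui wi]; rewrite !oo'.
  by case: eqP => // ri'; apply/ltnW/oi; lia.
case: eqP => [->|uni]; case: eqP => [->|wni] // ow.
- by have := oi w; lia.
- by have := oi u; lia.
- by apply: oinj => //; lia.
Qed.

Section Run.
Variables (n D V : nat).
Hypotheses (D_gt0 : 0 < D) (D_le_V : D <= V).

(** A start is computed from the previous one by at most five additions or subtractions of input
    values (a, L, b, L, a), each with numerator at most [V]; hence 5 V per job. *)
Let K := 5 * V * n.+1.

Let D_le_K : D <= K.
Proof. by rewrite /K; nia. Qed.

Local Notation good := (good n.+1 D K).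
Local Notation halts := (halts n n.+1 D K).
Local Notation halts_iset := (halts_iset n (ltn0Sn n) D_gt0 D_le_K).
Local Notation halts_qset := (halts_qset n (ltn0Sn n) D_gt0 D_le_K).
Local Notation halts_if := (halts_if (ltn0Sn n) D_gt0 D_le_K).
Local Notation halts_while := (halts_while (ltn0Sn n) D_gt0 D_le_K).

(** * Correctness of the insertion sort *)

Section Sort.
Variable q : nat -> nat -> rat.

Definition key (i : nat) : rat := (q ya i + q yb i)%R.

Definition sort_frame m : Prop := [/\ good m, qmem m = q & imem m xn 0 = n].

(* While the [i]-th job moves down, only its current position [k] may violate
   the order. *)
Definition inner_inv i k m : Prop :=
  [/\ sort_frame m, imem m xi 0 = i, imem m xk 0 = k, k <= i < n &
      perm_upto (imem m xord) i.+1 /\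
      forall u w, u < w <= i -> w != k ->
        (key (imem m xord u) <= key (imem m xord w))%R].

Definition outer_inv v m : Prop :=
  [/\ sort_frame m, v <= n, imem m xi 0 = n - v,
      perm_upto (imem m xord) (n - v) &
      forall u w, u < w < n - v ->
        (key (imem m xord u) <= key (imem m xord w))%R].

Lemma sort_prog_halts m : sort_frame m -> halts sort_prog m (outer_inv 0).
Proof.
move=> [gm qm nm]; rewrite /sort_prog.
apply: halts_seq; apply: halts_iset => //.
apply: (halts_while (P := outer_inv) (v := n)) => //; first last.
- rewrite /outer_inv subnn /=; split=> // [|u w]; last by rewrite ltn0 andbF.
  by split=> //; exact: good_iset.
- move=> v m' [[gm' qm' nm'] vn iv ov sv] /=; rewrite iv nm' -leqNgt => nv.
  have v0 : v = 0 by lia.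
  by rewrite v0 in iv ov sv.
- move=> v {gm qm nm}m [[gm qm nm] vn im om sm] /=; rewrite im nm => vn'.
  exists v.-1; first by lia.
  set i := n - v in im om sm vn'; have iE : n - v.-1 = i.+1 by lia.
  apply: halts_seq; apply: halts_iset => //=; rewrite im.
  set m1 := Memory _ _;
  have gm1 : good m1 by apply: (good_iset (m := m)) => //; lia.
  apply: halts_seq; apply: halts_iset => //=.
  rewrite -[upd _ _ _ _ xi 0]/(imem m xi 0) im.
  set m2 := Memory _ _;
  have gm2 : good m2 by apply: (good_iset (m := m1)) => //; lia.
  apply: halts_seq; apply: (halts_while (P := inner_inv i) (v := i)) => //.
  + by lia.
  + by move=> k m' [[]].
  + move=> k m' [[gm' qm' nm'] im' km' ki [om' sm']] /=; rewrite km'.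
    move=> /andP[k0 lt]; exists (k - 1); first by lia.
    have ok r : r <= i -> imem m' xord r <= n.+1.
      by move=> ri; have := om'.1 r; lia.
    apply: halts_seq; apply: halts_iset => //=; rewrite km'.
    set m3 := Memory _ _;
    have gm3 : good m3 by apply: (good_iset (m := m')) => //; apply: ok; lia.
    apply: halts_seq; apply: halts_iset => //=; rewrite /upd /= km'.
    set m4 := Memory _ _;
    have gm4 : good m4 by apply: (good_iset (m := m3)) => //; apply: ok; lia.
    apply: halts_seq; apply: halts_iset => //=; rewrite /upd /= km'.
    set m5 := Memory _ _;
    have gm5 : good m5 by apply: (good_iset (m := m4)) => //; apply: ok; lia.
    apply: halts_iset => //=; rewrite /upd /= km'.
    set m6 := Memory _ _;
    have gm6 : good m6 by apply: (good_iset (m := m5)) => //; lia.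
    have o6 : imem m6 xord =1 swap_pred (imem m' xord) k.
      by move=> r; rewrite /= /upd.
    split=> //; first by lia.
    split; first by apply: perm_upto_swap o6 om'; lia.
    (* The failed test orders the swapped pair itself; every other pair was in order before the
       swap. *)
    move=> u w uw wk; rewrite !o6 /swap_pred.
    rewrite qm' -/(key _) -/(key _) -ltNge in lt.
    do 4?[case: eqP => ? /=]; try lia; try exact: ltW; by apply: sm'; lia.
  + move=> k m' [[gm' qm' nm'] im' km' ki [om' sm']] /=; rewrite km'.
    rewrite qm' -/(key _) -/(key _) negb_and negbK -leqNgt leqn0 => stop.
    apply: halts_iset => //=; rewrite /outer_inv iE /= /upd /= im'.
    split=> //; rewrite ?addn1 //; [|by lia|].
      by split=> //; apply: good_iset => //; lia.
    move=> u w /andP[uw wi].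
    (* The exit test compares position [k] with [k - 1] only; transitivity extends this to all
       earlier positions. *)
    have [wk|wk] := eqVneq w k; last by apply: sm' => //; lia.
    have {stop} : (key (imem m' xord (k - 1)) <= key (imem m' xord k))%R.
      by case/orP: stop => // ?; lia.
    rewrite -wk; have [->|uk] := eqVneq u (w - 1) => //.
    by apply: le_trans; apply: sm'; lia.
  + have o2 : imem m2 xord =1 (fun r => if r == i then i else imem m xord r).
      by move=> r.
    split=> //; first by lia.
    split; first exact: perm_upto_last o2 om.
    move=> u w uw wi; rewrite !o2; do 2?[case: eqP => ? /=]; try lia.
    by apply: sm; lia.
- by move=> v m' [[]].
Qed.

End Sort.

(** * Correctness of the scheduling loop *)

Section Schedule.
Variables (a b : 'I_n -> rat) (L : rat) (f : 'I_n -> 'I_n).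
Hypothesis f_inj : injective f.

Local Notation order := (codom f).

Lemma take_order (j : 'I_n) :
  take j.+1 order = rcons (take j order) (f j).
Proof.
rewrite (take_nth (f j)) ?size_codom ?card_ord //; congr rcons.
by rewrite /codom /image_mem (nth_map j) ?nth_ord_enum // size_enum_ord.
Qed.

Record alg2_frame m : Prop := AlgFrame {
  frame_good : good m;
  frame_n : imem m xn 0 = n;
  frame_ord : forall r : 'I_n, imem m xord r = f r;
  frame_a : forall i : 'I_n, qmem m ya i = a i;
  frame_b : forall i : 'I_n, qmem m yb i = b i;
  frame_L : qmem m yL 0 = L }.

Definition fits_inv m0 (S : 'I_n -> rat) (j : 'I_n) v m : Prop :=
  [/\ good m, qmem m = qmem m0, v <= j,
      forall y k, y != xok -> y != xk -> imem m y k = imem m0 y k &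
      imem m xk 0 = j - v /\
      imem m xok 0 = fits a b L (take (j - v) order) S (f j) (qmem m0 ys 0)].

Lemma fits_prog_halts m (S : 'I_n -> rat) (j : 'I_n) :
  alg2_frame m -> imem m xj 0 = j ->
  (forall r : 'I_n, r < j -> qmem m yS (f r) = S (f r)) ->
  halts fits_prog m (fits_inv m S j 0).
Proof.
move=> [gm nm om am bm Lm] jm Sm; rewrite /fits_prog.
apply: halts_seq; apply: halts_iset => //=.
set m1 := Memory _ _; have gm1 : good m1 by apply: (good_iset (m := m)).
apply: halts_seq; apply: halts_iset => //=.
set m2 := Memory _ _; have gm2 : good m2 by apply: (good_iset (m := m1)).
apply: (halts_while (P := fits_inv m S j) (v := j)) => //.
- by exact: ltnW.
- by move=> v m' [].
- move=> v m' [gm' qm' vj im' [km' okm']] /=.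
  rewrite km' im' // jm => vj'; exists v.-1; first by lia.
  have kj : j - v < n by have := ltn_ord j; lia.
  pose k := Ordinal kj; have kE : j - v = k by [].
  have jvE : j - v.-1 = k.+1 by rewrite /=; lia.
  (* The state between the test and the increment of [k]: [ok] already accounts for job [k]. *)
  pose Q m'' := [/\ good m'', qmem m'' = qmem m,
      forall y k, y != xok -> y != xk -> imem m'' y k = imem m y k &
      imem m'' xk 0 = k /\
      imem m'' xok 0 = fits a b L (take k.+1 order) S (f j) (qmem m ys 0)].
  apply: halts_seq; apply: (@halts_imp _ _ _ _ _ _ Q).
    move=> m'' [gm'' qm'' im'' [km'' okm'']].
    apply: halts_iset => //=; rewrite km''.
    set m3 := Memory _ _;
    have gm3 : good m3.
      by apply: (good_iset (m := m'')) => //; rewrite /=; lia.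
    split=> //; first by lia.
      move=> y i yok yk; rewrite /= /upd (negPf yk) /=; exact: im''.
    by rewrite jvE /= /upd /= addn1 okm''.
  have fitsE : fits a b L (take k.+1 order) S (f j) (qmem m ys 0) =
      [&& clear (qmem m ys 0) (a (f j)) (S (f k)) (a (f k)),
          clear (qmem m ys 0) (a (f j)) (S (f k) + a (f k) + L) (b (f k)),
          clear (qmem m ys 0 + a (f j) + L) (b (f j)) (S (f k)) (a (f k))
        & clear (qmem m ys 0 + a (f j) + L) (b (f j))
            (S (f k) + a (f k) + L) (b (f k))]%R &&
      fits a b L (take k order) S (f j) (qmem m ys 0).
    by rewrite take_order /fits all_rcons.
  move: fitsE; set no_clash := [&& _, _, _ & _] => fitsE.
  have jm' : imem m' xj 0 = j by rewrite im'.
  have om' (r : 'I_n) : imem m' xord r = f r by rewrite im'.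
  apply: halts_if => //=.
  + rewrite jm' km' kE !om' qm' !am !bm Lm Sm; last by rewrite /=; lia.
    (* Once reassociated, the test evaluated by the machine is convertible to [no_clash]. *)
    rewrite -!andbA => cl; have {}cl : no_clash := cl; apply: halts_skip.
    by split=> //; rewrite km' fitsE okm' cl.
  + rewrite jm' km' kE !om' qm' !am !bm Lm Sm; last by rewrite /=; lia.
    rewrite -!andbA => cl; have {}cl : ~~ no_clash := cl;
      apply: halts_iset => //=.
    split=> //; first exact: good_iset.
      by move=> y i yok yk; rewrite /= /upd (negPf yok) /=; exact: im'.
    by rewrite /= /upd /= km' fitsE (negPf cl).
- move=> v m' [gm' qm' vj im' [km' okm']] /=.
  rewrite km' im' // jm -leqNgt => jv.
  have v0 : v = 0 by have := ltn_ord j; lia.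
  by move: km' okm'; rewrite v0 => *; split.
- split=> //; first by move=> y k yok yk;
    rewrite /= /upd (negPf yok) (negPf yk).
  by rewrite subnn take0.
Qed.

Lemma fits_inv_frame m0 m S j : alg2_frame m0 -> fits_inv m0 S j 0 m ->
  alg2_frame m.
Proof.
move=> [gm nm om am bm Lm] [gm' qm' _ im' _].
by split=> // *; rewrite ?qm' ?im' ?om.
Qed.

Lemma alg2_frame_qset m x k v : alg2_frame m -> (x == yS) || (x == ys) ->
  smallq D K v -> alg2_frame (Memory (imem m) (upd (qmem m) x k v)).
Proof.
move=> [gm nm om am bm Lm] xS sv.
split=> //= [|i|i|]; first exact: good_qset.
all: by rewrite /upd; case/orP: xS => /eqP-> /=.
Qed.

Definition alg2_state (j : nat) : seq 'I_n * ('I_n -> rat) :=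
  foldl (alg2_step a b L) ([::], fun=> 0%R) (take j order).

Lemma alg2_state1 j : (alg2_state j).1 = rev (take j order).
Proof.
rewrite /alg2_state; elim/last_ind: (take j order) => // s i IHs.
by rewrite foldl_rcons /= IHs rev_rcons.
Qed.

Lemma alg2_stateS (j : 'I_n) :
  alg2_state j.+1 = alg2_step a b L (alg2_state j) (f j).
Proof. by rewrite /alg2_state take_order foldl_rcons. Qed.

Definition next_start (S : 'I_n -> rat) (p j : 'I_n) : rat :=
  let after_first := (S (f p) + a (f p))%R in
  let after_second := (S (f p) + a (f p) + L + b (f p))%R in
  if fits a b L (take j order) S (f j) after_first then after_first
  else if fits a b L (take j order) S (f j) (after_second - L - a (f j))
  then (after_second - L - a (f j))%R
  else after_second.

(** The algorithm keeps the latest job first while the program scans from the earliest; [fits] is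
    insensitive to the order, and the head of the reversed list is the previous job. *)
Lemma start_time_next S (p j : 'I_n) : j = p.+1 :> nat ->
  start_time a b L (rev (take j order)) S (f j) = next_start S p j.
Proof.
move=> jp; have fitsE x : fits a b L (rev (take j order)) S (f j) x =
    fits a b L (take j order) S (f j) x by rewrite /fits all_rev.
have headE : rev (take j order) = f p :: rev (take p order).
  by rewrite jp take_order rev_rcons.
by rewrite /next_start -!fitsE headE.
Qed.

Section Step.
Variables (S : 'I_n -> rat) (j : 'I_n).

Definition step_frame m : Prop :=
  [/\ alg2_frame m, imem m xj 0 = j &
      forall r : 'I_n, r < j -> qmem m yS (f r) = S (f r)].

(** Rule for the pattern common to attempts (i) and (ii): store a candidate start, then test it. *)
Lemma try_start m (e : qexp) s c (Q : memory -> Prop) :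
  step_frame m -> qeval m e = s -> qweight e < 256 -> smallq D K s ->
  (forall m', step_frame m' -> qmem m' ys 0 = s ->
     imem m' xok 0 = fits a b L (take j order) S (f j) s -> halts c m' Q) ->
  halts (Seq (QSet ys (ICst 0) e) (Seq fits_prog c)) m Q.
Proof.
move=> [fm jm Sm] es we ss hc.
apply: halts_seq; apply: halts_qset => //; first exact: frame_good fm.
  by move: we; rewrite /max_weight /=; lia.
rewrite /= es; set m1 := Memory _ _.
have fm1 : alg2_frame m1 by apply: alg2_frame_qset.
apply: halts_seq; apply: halts_imp (fits_prog_halts fm1 jm Sm) => m2 inv2.
have fm2 := fits_inv_frame fm1 inv2.
have [gm2 qm2 _ im2 [_ okm2]] := inv2.
apply: hc; first by split=> // [|r rj]; rewrite ?im2 // qm2; exact: Sm.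
  by rewrite qm2.
by rewrite okm2 subn0.
Qed.

End Step.

(** The first job is placed before the loop, whence the positivity of the counter; the numerator
    bound grows with the rank [r]. *)
Definition main_inv v m : Prop :=
  [/\ alg2_frame m, 0 < imem m xj 0, v = n - imem m xj 0 &
      forall r : 'I_n, r < imem m xj 0 ->
        qmem m yS (f r) = (alg2_state (imem m xj 0)).2 (f r) /\
        smallq D (5 * V * r) (qmem m yS (f r))].

Hypotheses (small_a : forall i, smallq D V (a i))
  (small_b : forall i, smallq D V (b i)) (small_L : smallq D V L).

(** Dropping three heads of [alg2_prog] leaves its main loop, which need not be copied out. *)
Definition seq_tail (c : cmd) : cmd := if c is Seq _ d then d else Skip.

Lemma alg2_loop_halts m : main_inv (n - imem m xj 0) m ->
  halts (iter 3 seq_tail alg2_prog) m (main_inv 0).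
Proof.
move=> inv; rewrite /alg2_prog [iter _ _ _]/=.
apply: (halts_while (P := main_inv)) inv => //.
- exact: leq_subr.
- by move=> v m' [[]].
- move=> v {}m [fm j0 -> Sm] /=; rewrite (frame_n fm) => jn.
  exists (n - (imem m xj 0).+1); first by lia.
  pose j := Ordinal jn; have pn : (imem m xj 0).-1 < n by lia.
  pose p := Ordinal pn; have jp : j = p.+1 :> nat by rewrite /= prednK.
  have jm : imem m xj 0 = j by [].
  have pm : j - 1 = p by rewrite jp subn1.
  set S := (alg2_state _).2 in Sm.
  have sfm : step_frame S j m.
    by split=> // r rj; have [-> _] := Sm r rj.
  have smallS (r : 'I_n) : r < j -> smallq D (5 * V * r) (S (f r)).
    by move=> rj; have [<-] := Sm r rj.
  have smallp : smallq D (5 * V * p) (S (f p)) by apply: smallS; rewrite jp.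
  have leK : 5 * V * j <= K by rewrite leq_mul2l ltnW ?orbT // ltnS ltnW.
  have small1 : smallq D (5 * V * j) (S (f p) + a (f p)).
    by apply: smallq_leq (smallqD smallp (small_a _)); rewrite jp; nia.
  have small3 : smallq D (5 * V * p + V + V + V) (S (f p) + a (f p) + L + b (f
    p)).
    by do !apply: smallqD.
  have small2 : smallq D (5 * V * j) (S (f p) + a (f p) + L + b (f p) - L - a
    (f j)).
    apply: smallq_leq (smallqB (smallqB small3 small_L) (small_a _)).
    by rewrite jp; nia.
  have {}small3 : smallq D (5 * V * j) (S (f p) + a (f p) + L + b (f p)).
    by apply: smallq_leq small3; rewrite jp; nia.
  have getp m' : step_frame S j m' ->
      [/\ imem m' xord (imem m' xj 0) = f j,
          imem m' xord (imem m' xj 0 - 1) = f p &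
          qmem m' yS (f p) = S (f p)].
    by move=> [fm' -> ->]; rewrite ?pm ?(frame_ord fm') // jp.
  (* The three branches of the program meet in this postcondition. *)
  pose placed m' := step_frame S j m' /\ qmem m' ys 0 = next_start S p j.
  apply: (@try_start S j m _ (S (f p) + a (f p))%R) => //.
  + by have [_ E2 E3] := getp _ sfm; rewrite /= E2 E3 (frame_a fm).
  + exact: smallq_leq small1.
  move=> m1 sf1 s1 ok1; apply: halts_seq;
    apply: (@halts_imp _ _ _ _ _ _ placed).
    move=> m' [[fm' jm' Sm'] sm'].
    apply: halts_seq; apply: halts_qset => //; first exact: frame_good fm'.
    rewrite /= jm' (frame_ord fm') sm'.
    set x := next_start S p j; set m2 := Memory _ _.
    have small_x : smallq D (5 * V * j) x.
      by rewrite /x /next_start; case: ifP => // _; case: ifP.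
    have fm2 : alg2_frame m2 by apply: alg2_frame_qset => //;
      exact: smallq_leq small_x.
    apply: halts_iset => //; first exact: frame_good fm2.
    rewrite /main_inv /upd /= jm' addn1; split=> //.
      case: fm2 => gm2 *; split=> //.
      by apply: (good_iset (m := m2)) => //; exact: ltnW.
    move=> r rj.
    have -> : (alg2_state j.+1).2 (f r) = if f r == f j then x else S (f r).
      by rewrite alg2_stateS /= alg2_state1 (start_time_next _ jp).
    have -> : upd (qmem m') yS (f j) x yS (f r) =
      if f r == f j then x else qmem m' yS (f r) by [].
    (* Distinct positions hold distinct jobs, so earlier starts are not overwritten. *)
    rewrite (inj_eq f_inj); case: eqP => [->//|/eqP rj'].
    have {}rj : r < j by rewrite ltn_neqAle -ltnS rj andbT val_eqE.
    by rewrite Sm' //; split=> //; exact: smallS.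
  have [fm1 _ _] := sf1; have g1 := frame_good fm1.
  apply: halts_if => //=; rewrite ok1 lt0b => fits1.
    apply: halts_skip; split=> //.
    by rewrite s1 /next_start fits1.
  apply: (@try_start S j m1 _ (S (f p) + a (f p) + L + b (f p) - L - a (f
    j))%R) => //.
  + have [E1 E2 E3] := getp _ sf1; have [_ _ _ fa fb fL] := fm1.
    by rewrite /= E1 E2 E3 !fa fb fL.
  + exact: smallq_leq small2.
  move=> m2 sf2 s2 ok2; have [fm2 _ _] := sf2; have g2 := frame_good fm2.
  apply: halts_if => //=; rewrite ok2 lt0b => fits2.
    apply: halts_skip; split=> //.
    by rewrite s2 /next_start (negPf fits1) fits2.
  apply: halts_qset => //=.
  have [E1 E2 E3] := getp _ sf2; have [_ _ _ fa fb fL] := fm2;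
    have [_ jm2 Sm2] := sf2.
  rewrite E2 E3 fa fb fL; split; last first.
    by rewrite /= /upd /= /next_start (negPf fits1) (negPf fits2).
  split=> //; apply: alg2_frame_qset => //; exact: smallq_leq small3.
- move=> v m' [fm j0 vE Sm] /=; rewrite (frame_n fm) -leqNgt => nj.
  by split=> //; lia.
Qed.

End Schedule.

Lemma alg2_prog_halts (a b : 'I_n -> rat) (L : rat) :
  (forall i, smallq D V (a i)) -> (forall i, smallq D V (b i)) ->
  smallq D V L ->
  halts alg2_prog (input a b L) (fun m => exists2 order,
    sorted_order a b order & forall j, output m j = alg2 a b L order j).
Proof.
move=> sa sb sL; set q := qmem (input a b L).
have qa (i : 'I_n) : q ya i = a i by rewrite /q /= valK.
have qb (i : 'I_n) : q yb i = b i by rewrite /q /= valK.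
have V_le_K : V <= K by rewrite /K; nia.
have small0 : smallq D K 0%R by apply: smallq_leq (smallq_nat _ 0).
have sort0 : sort_frame q (input a b L).
  split=> //; split=> [x i|y i] /=.
    by case: ifP.
  case: ifP => _; first by case: ifP => // _; exact: smallq_leq V_le_K sL.
  have cells (g : 'I_n -> rat) : (forall j, smallq D V (g j)) ->
      smallq D K (oapp g 0%R (insub i)).
    by move=> sg; case: (insub i : option 'I_n) => [j|] //=;
      exact: smallq_leq V_le_K _.
  by do 2![case: ifP => _; first exact: cells].
rewrite /alg2_prog; apply: halts_seq.
apply: halts_imp (sort_prog_halts sort0) => {sort0} m [[gm qm nm] _ _].
rewrite subn0 => -[o_lt o_inj] o_sorted.
pose f (r : 'I_n) : 'I_n := Ordinal (o_lt r (ltn_ord r)).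
have f_inj : injective f.
  by move=> r r' [/o_inj E]; apply/val_inj/E.
have fm : alg2_frame a b L f m by split=> // *; rewrite qm ?qa ?qb.
pose started m' := alg2_frame a b L f m' /\
  forall r : 'I_n, r < 1 -> qmem m' yS (f r) = 0%R.
apply: halts_seq; apply: (@halts_imp _ _ _ _ _ _ started); last first.
  apply: halts_if => //=; rewrite nm => n0; last first.
    apply: halts_skip; split=> // r; have := ltn_ord r; lia.
  apply: halts_qset => //; split=> /=.
    exact: alg2_frame_qset.
  move=> r r1; rewrite /upd /=; have r0 : r = 0 :> nat by lia.
  by rewrite r0 eqxx.
move=> m1 [fm1 S1]; apply: halts_seq; apply: halts_iset => //.
  exact: frame_good fm1.
rewrite /=; set m2 := Memory _ _.
have inv2 : main_inv a b L f (n - imem m2 xj 0) m2.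
  split=> //.
    by case: fm1 => g1 *; split=> //; apply: (good_iset (m := m1)).
  rewrite /= /upd /= => r r1; rewrite S1 //; split; last first.
    by apply: smallq_leq (smallq_nat _ 0).
  have r0 : r = 0 :> nat by lia.
  by rewrite -{1}r0 alg2_stateS /= eqxx alg2_state1 r0 take0.
apply: halts_imp (alg2_loop_halts f_inj sa sb sL inv2) => m3 [fm3 j0 nj S3].
exists (codom f); last first.
  move=> j; have [g _ gK] := injF_bij f_inj; rewrite -(gK j).
  have gj : g j < imem m3 xj 0 by have := ltn_ord (g j); lia.
  have [out _] := S3 _ gj; rewrite /output out.
  by rewrite /alg2_state take_oversize // size_codom card_ord; lia.
apply/andP; split.
  apply: uniq_perm; rewrite ?enum_uniq //.
    by rewrite map_inj_uniq ?enum_uniq.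
  move=> j; have [g _ gK] := injF_bij f_inj.
  by rewrite mem_enum -[j]gK codom_f.
(* [codom f] lists the jobs by increasing position, and the sort orders all pairs of positions. *)
rewrite /codom /image_mem sorted_map.
apply: (@sub_sorted _ (fun i j : 'I_n => i < j)); last first.
  have := iota_ltn_sorted 0 n; rewrite -val_enum_ord sorted_map.
  exact: sub_sorted.
move=> i j ij /=; have := o_sorted i j; rewrite ij ltn_ord => /(_ isT).
by rewrite /key -!qa -!qb.
Qed.

End Run.

(** * The polynomial bound *)

Lemma smallq_denq D x : `|denq x| %| D -> smallq D (`|numq x| * D) x.
Proof.
move=> /dvdnP[d ->]; exists (numq x * d%:Z)%R; last first.
  by rewrite abszM absz_nat leq_mul2l leq_pmulr ?orbT ?absz_gt0 ?denq_neq0.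
rewrite mulnC natrM mulrA rmorphM /=; congr (_ * _)%R.
rewrite -[X in (X * _)%R]divq_num_den -mulrA.
have -> : (`|denq x|%N%:R = (denq x)%:~R :> rat)%R.
  by rewrite -[in RHS](gtz0_abs (denq_gt0 x)).
by rewrite mulVf ?mulr1 // intr_eq0 denq_neq0.
Qed.

Lemma alg2_prog_polynomial :
  exists p : {poly nat}, forall (n : nat) (a b : 'I_n -> rat) (L : rat),
  exists (t : nat) (m : memory) (order : seq 'I_n),
    [/\ exec alg2_prog (input a b L) t m,
        t <= p.[input_size a b L]%R,
        sorted_order a b order
      & forall j, output m j = alg2 a b L order j].
Proof.
(* Loops nest to depth two, giving at most 100 (N + 1) ^ 2 steps; each costs at most [max_weight]
   times 25 (N + 1). *)
exists ((100 * (max_weight * 25))%:P * ('X + 1) ^+ 3)%R => n a b L.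
set N := input_size a b L.
pose D := `|denq L| * \prod_(j < n) (`|denq (a j)| * `|denq (b j)|).
have den_gt0 x : 0 < `|denq x| by rewrite absz_gt0 denq_neq0.
have D_gt0 : 0 < D.
  by rewrite muln_gt0 den_gt0 prodn_gt0 // => j; rewrite muln_gt0 !den_gt0.
(* The bit sizes of all the denominators are disjoint parts of the input size. *)
have D_le : D <= 2 ^ N.
  rewrite /D /N /input_size -addnA; apply: leq_trans (_ : 2 ^ (nbits `|denq L| +
    \sum_(j < n) (nbits `|denq (a j)| + nbits `|denq (b j)|)) <= _); last first.
    rewrite leq_exp2l // /qbits.
    apply: leq_trans (leq_addl _ _); apply: leq_add; first exact: leq_addl.
    by apply: leq_sum => j _; apply: leq_add; exact: leq_addl.
  rewrite expnD leq_mul ?(ltnW (ltn_nbits _)) // expn_sum leq_prod // => j _.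
  by rewrite expnD leq_mul ?(ltnW (ltn_nbits _)).
have D_le_V : D <= 2 ^ (N + N) by apply: leq_trans D_le _;
  rewrite leq_exp2l ?leq_addr.
(* One factor 2 ^ N bounds the numerator of [x], the other bounds [D]. *)
have small x : `|denq x| %| D -> qbits x <= N -> smallq D (2 ^ (N + N)) x.
  move=> xD xN; apply: smallq_leq (smallq_denq xD).
  rewrite expnD leq_mul //; apply: leq_trans (ltnW (ltn_nbits _)) _.
  by rewrite leq_exp2l //; apply: leq_trans xN; exact: leq_addr.
have sum_bits j : qbits (a j) + qbits (b j) <=
    \sum_(j < n) (qbits (a j) + qbits (b j)) by rewrite (bigD1 j) //= leq_addr.
have prod_den j : `|denq (a j)| * `|denq (b j)| %| D.
  by rewrite dvdn_mull // (bigD1 j) //= dvdn_mulr.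
have nN : n <= N.
  rewrite /N /input_size; apply: leq_trans (leq_addl _ _).
  rewrite -[n in n <= _]card_ord -sum1_card; apply: leq_sum => j _.
  by rewrite /qbits /nbits; lia.
have [||| t [m [ex tle [order ord out]]]] :=
  alg2_prog_halts D_gt0 D_le_V (a := a) (b := b) (L := L).
- move=> i; apply: small;
    first exact: dvdn_trans (dvdn_mulr _ (dvdnn _)) (prod_den i).
  by have := sum_bits i; rewrite /N /input_size; lia.
- move=> i; apply: small;
    first exact: dvdn_trans (dvdn_mull _ (dvdnn _)) (prod_den i).
  by have := sum_bits i; rewrite /N /input_size; lia.
- by apply: small; rewrite ?dvdn_mulr // /N /input_size; lia.
exists t, m, order; split=> //; apply: leq_trans tle _.
have -> : ((100 * (max_weight * 25))%:P * ('X + 1) ^+ 3).[N]%R =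
    100 * (max_weight * 25) * N.+1 ^ 3 by rewrite !hornerE -[N.+1]addn1.
have n2N : n.+1 <= 2 ^ N by apply: leq_trans (ltn_expl n (ltnSn 1)) _;
  rewrite leq_exp2l.
(* The three sizes are at most N + 10, 3 N + 13 and N + 1: 9 bits come from [max_weight] and 3 from
   the factor 5. *)
have bits : value_bits n.+1 D (5 * 2 ^ (N + N) * n.+1) <= 25 * N.+1.
  have b1 : nbits (max_weight * n.+1) <= (9 + N).+1.
    by apply: nbits_exp2; rewrite expnD leq_mul.
  have b2 : nbits (max_weight * (5 * 2 ^ (N + N) * n.+1)) <= (9 + (3 + (N + N)
    + N)).+1.
    apply: nbits_exp2.
    have -> : 2 ^ (9 + (3 + (N + N) + N)) = max_weight * (2 ^ 3 * 2 ^ (N + N)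
      * 2 ^ N).
      by rewrite [max_weight](_ : _ = 2 ^ 9) // -!expnD.
    by rewrite !leq_mul.
  have b3 : nbits D <= N.+1 by exact: nbits_exp2.
  by rewrite /value_bits; lia.
have steps_le : steps n alg2_prog <= 100 * N.+1 ^ 2.
  rewrite /=; nia.
apply: leq_trans (leq_mul steps_le (leq_mul (leqnn _) bits)) _.
move: max_weight N.+1 => w x; rewrite leq_eqVlt; apply/orP; left.
by apply/eqP; rewrite !expnS expn0; nia.
Qed.

(** * Approximation factor *)

Local Open Scope ring_scope.

(** * Lower bounds on the optimum *)

Lemma load_le (R : realFieldType) (T : finType) (x p : T -> R)
    (A : {set T}) (c : R) :
  0 <= c -> (forall u, 0 < p u) ->
  {in A, forall u, 0 <= x u /\ x u + p u <= c} ->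
  {in A &, forall u v, u != v -> clear (x u) (p u) (x v) (p v)} ->
  \sum_(u in A) p u <= c.
Proof.
move=> + p0; have [m] := ubnP #|A|.
elim: m A c => // m IHm A c Am c0 Ac Aclear.
have [->|[u0 u0A]] := set_0Vmem A; first by rewrite big_set0.
(* Remove the task [u] that ends last: all the others end before it starts, so the induction applies
   with [x u] in place of [c]. *)
case: (@arg_maxP _ R _ u0 (mem A) (fun u => x u + p u) u0A) => u uA' umax.
have {uA'} uA : u \in A := uA'.
have [xu uc] := Ac u uA.
have sub v : v \in A :\ u -> v \in A by case/setD1P.
rewrite (big_setD1 u) //= -lerBrDl; apply: le_trans (_ : x u <= _).
  2: by rewrite lerBrDr.
apply: IHm => // [|v vA|v w /sub vA /sub wA].
- by rewrite (cardsD1 u) uA in Am.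
- have [vu {}vA] := setD1P vA; have [xv _] := Ac v vA; split=> //.
  case/orP: (Aclear v u vA uA vu) => // uv.
  have /= := umax v vA; have := p0 v; have := p0 u; lra.
- exact: Aclear.
Qed.

Section Approximation.
Variables (R : realFieldType) (n : nat) (a b : 'I_n -> R) (L : R).
Hypotheses (a_gt0 : forall j, 0 < a j) (b_gt0 : forall j, 0 < b j).
Hypothesis L_ge0 : 0 <= L.
Implicit Types (S : 'I_n -> R) (s : seq 'I_n).

Local Notation C := (completion a b (fun=> L)).

Definition load s : R := \sum_(i <- s) (a i + b i).

(* For a list with the last job first, the sum of the loads of all prefixes of
   the schedule. *)
Fixpoint total_load s : R :=
  if s is _ :: s' then total_load s' + load s else 0.

(** The tasks of the jobs completed by time [C S j] are disjoint and lie between 0 and that time. *)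
Lemma feasible_load S : feasible a b (fun=> L) S ->
  forall j, \sum_(i | C S i <= C S j) (a i + b i) <= C S j.
Proof.
have L0 := L_ge0; move=> [S0 disj] j; pose l := fun _ : 'I_n => L.
have len0 u : 0 < task_length a b u by rewrite /task_length; case: ifP.
have -> : \sum_(i | C S i <= C S j) (a i + b i) =
    \sum_(u in [set u | C S u.1 <= C S j]) task_length a b u.
  under [RHS]eq_bigl => u do rewrite inE -[_ <= _]andbT.
  rewrite -(pair_big_dep (fun i => C S i <= C S j) (fun _ _ => true)
             (fun i c => task_length a b (i, c))) /=.
  by apply: eq_bigr => i _; rewrite big_bool /= addrC.
apply: (load_le (x := task_start a l S)) => //.
- have := S0 j; have := a_gt0 j; have := b_gt0 j; rewrite /completion /=; lra.
- move=> [i c]; rewrite inE /task_start /task_length /completion /=.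
  have := S0 i; have := a_gt0 i; have := b_gt0 i; rewrite /l.
  by case: c => /= ? ? ? ?; split; lra.
- move=> u v _ _ uv; apply/(clearP _ _ (len0 u) (len0 v)) => t.
  exact: disj.
Qed.

(** Induction on the list, whose head [h] has the largest load. For each later entry [i], either [i]
    completes no later than [h] and its load counts in the sum of [h], or the load of [h], at least
    as large, counts in the sum of [i]. *)
Lemma total_load_le S s :
  sorted (fun i j => a j + b j <= a i + b i) s -> 
  total_load s <= \sum_(j <- s) \sum_(i <- s | C S i <= C S j) (a i + b i).
Proof.
elim: s => [|h t IHt] ht; first by rewrite big_nil.
have {}IHt := IHt (path_sorted ht).
have {ht} ht : all (fun i => a i + b i <= a h + b h) t.
  by apply: order_path_min ht => x y z xy yz; exact: le_trans yz xy.
rewrite /= /load !big_cons lexx.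
under [X in _ <= _ + X]eq_bigr => j _ do rewrite big_cons.
have split_h j (s' : R) :
    (if C S h <= C S j then a h + b h + s' else s') =
    (if C S h <= C S j then a h + b h else 0) + s'.
  by case: ifP; rewrite ?add0r.
under [X in _ <= _ + X]eq_bigr => j _ do rewrite split_h.
rewrite [X in _ <= _ + X]big_split /=.
suff : \sum_(i <- t) (a i + b i) <=
    \sum_(i <- t | C S i <= C S h) (a i + b i) +
    \sum_(j <- t) (if C S h <= C S j then a h + b h else 0) by lra.
rewrite [X in _ <= X + _]big_mkcond -big_split /= !big_seq.
apply: ler_sum => i it; have := allP ht i it.
have := a_gt0 i; have := b_gt0 i; have := a_gt0 h; have := b_gt0 h.
by case: (leP (C S i)) => ih; case: (leP (C S h)) => hi; lra.
Qed.

Lemma optimum_ge S order : feasible a b (fun=> L) S -> sorted_order a b order ->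
  total_load (rev order) <= total_completion a b (fun=> L) S.
Proof.
move=> Sf /andP[perm_order sorted_order].
have perm_rev : perm_eq (rev order) (enum 'I_n) by rewrite perm_rev.
apply: le_trans (total_load_le S _) _; first by rewrite rev_sorted.
rewrite /total_completion (perm_big _ perm_rev) /= big_enum /=.
apply: ler_sum => j _; rewrite (perm_big _ perm_rev) /= big_enum_cond /=.
exact: feasible_load.
Qed.

(** * The block invariant and its preservation *)

Definition separate S i j : bool :=
  [&& clear (S j) (a j) (S i) (a i),
      clear (S j) (a j) (S i + a i + L) (b i),
      clear (S j + a j + L) (b j) (S i) (a i)
    & clear (S j + a j + L) (b j) (S i + a i + L) (b i)].

Lemma separateC S i j : separate S i j = separate S j i.
Proof.
have clearC (x p y q : R) : clear x p y q = clear y q x p by exact: orbC.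
rewrite /separate (clearC (S j)) (clearC (S j) _ (S i + a i + L)).
by rewrite (clearC (S j + a j + L)) (clearC (S j + a j + L)); congr (_ && _);
  exact: andbCA.
Qed.

(* [E] is the end of the first task of the first job of the current block and
   [Q] the sum of [a i + b k] over the consecutive jobs [k], [i] of this block;
   as long as [Q + a j + b h <= L] the next job [j] can join the block. *)
Definition block_inv s S : Prop :=
  if s isn't h :: _ then True else
  exists E Q, [/\ 0 <= Q, E <= S h + a h <= E + Q,
    C S h + Q + b h <= 2 * load s + L
  & {in s, forall i, [/\ S i + a i <= S h + a h, C S i <= C S h
                      & C S i <= E \/ E <= S i + a i]}].

(** The last clause accumulates C_j <= 2 P_j + L, which the block invariant yields for each job when
    it is appended. *)
Definition alg2_inv (st : seq 'I_n * ('I_n -> R)) : Prop :=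
  [/\ {in st.1, forall i, 0 <= st.2 i},
      {in st.1 &, forall i j, i != j -> separate st.2 i j},
      block_inv st.1 st.2
    & \sum_(i <- st.1) C st.2 i <= 2 * total_load st.1 + L *+ size st.1].

(** Suppose Q + a_j + b_h < L. Attempt (i) succeeds if b_h <= a_j, and attempt (ii) otherwise: the
    first task of [j] ends before E + L, hence before any second task of the block, and starts after
    E, when the earlier blocks are over; its second task starts no earlier than the completion of
    [h]. *)
Lemma not_fits_block s h S j E Q :
  0 <= Q -> E <= S h + a h <= E + Q ->
  {in s, forall i, [/\ S i + a i <= S h + a h, C S i <= C S h
                    & C S i <= E \/ E <= S i + a i]} ->
  ~~ fits a b L s S j (S h + a h) ->
  ~~ fits a b L s S j (C S h - L - a j) ->
  L <= Q + a j + b h.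
Proof.
have L0 := L_ge0; move=> Q0 /andP[Eh hE] sh nf1 nf2; rewrite leNgt;
  apply/negP => QL.
have aj := a_gt0 j; have bj := b_gt0 j; have ah := a_gt0 h; have bh := b_gt0 h.
have [hj|jh] := leP (b h) (a j).
  case/negP: nf1; apply/allP => i /sh []; rewrite /completion.
  have := a_gt0 i; have := b_gt0 i; rewrite /clear => ? ? ? ? H.
  apply/and4P; split; apply/orP.
  - by right; lra.
  - by case: H => ?; [right|left]; lra.
  - by right; lra.
  - by right; lra.
case/negP: nf2; apply/allP => i /sh []; rewrite /completion.
have := a_gt0 i; have := b_gt0 i; rewrite /clear => ? ? ? ? H.
apply/and4P; split; apply/orP.
- by right; lra.
- by case: H => ?; [right|left]; lra.
- by right; lra.
- by right; lra.
Qed.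

Lemma alg2_step_inv st j :
  j \notin st.1 -> alg2_inv st -> alg2_inv (alg2_step a b L st j).
Proof.
have L0 := L_ge0; case: st => s S /= js [/= S0 sepS blockS totalS].
set x := start_time a b L s S j.
have aj := a_gt0 j; have bj := b_gt0 j.
have S'j : (if j == j then x else S j) = x by rewrite eqxx.
have S's i : i \in s -> (if i == j then x else S i) = S i.
  by case: eqP => // ->; rewrite (negPf js).
(* Earlier starts do not change, so only properties of the new start [x] remain. *)
suff [x0 sepx blockx] : [/\ 0 <= x, fits a b L s S j x &
    exists E Q, [/\ 0 <= Q, E <= x + a j <= E + Q,
      x + a j + L + b j + Q + b j <= 2 * load (j :: s) + L
    & {in s, forall i, [/\ S i + a i <= x + a j, C S i <= x + a j + L + b j
                      & C S i <= E \/ E <= S i + a i]}]].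
  have {}sepx i : i \in s -> separate (fun k => if k == j then x else S k) i j.
    by move=> si; rewrite /separate S'j S's //; exact: (allP sepx).
  rewrite /alg2_step /= -/x; split=> /=.
  - by move=> i; rewrite inE; case: eqP => //= _; exact: S0.
  - move=> i k; rewrite !inE => /predU1P[->|si] /predU1P[->|sk].
    + by rewrite eqxx.
    + by move=> _; rewrite separateC; exact: sepx.
    + by move=> _; exact: sepx.
    + by move=> ik; rewrite /separate !S's //; exact: sepS.
  - case: blockx => E [Q [Q0 EQ le ss]]; exists E, Q.
    rewrite /completion eqxx; split=> // i; rewrite inE => /predU1P[->|si].
      by rewrite eqxx; split=> //; right; case/andP: EQ.
    by rewrite S's //; exact: ss.
  - case: blockx => E [Q [Q0 EQ le ss]].
    rewrite big_cons /completion eqxx mulrS.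
    rewrite (_ : \sum_(i <- s) _ = \sum_(i <- s) C S i); first by lra.
    by rewrite !big_seq; apply: eq_bigr => i si; rewrite S's.
clear S's S'j; move: js S0 sepS blockS totalS @x;
  case: s => [|h t] js S0 _ block _.
  move=> x; split=> //=; exists (a j), 0; rewrite /load big_seq1 /x /=.
  by split=> //; try lra; apply/andP; split; lra.
case: block => E [Q [Q0 /andP[Eh hE] le ss]] x.
have [Sh bh] : 0 <= S h /\ 0 < b h by rewrite S0 ?mem_head.
have ah := a_gt0 h.
have loadE : load (j :: h :: t) = a j + b j + load (h :: t).
  by rewrite /load big_cons.
have xE : x = if fits a b L (h :: t) S j (S h + a h) then S h + a h
    else if fits a b L (h :: t) S j (C S h - L - a j) then C S h - L - a j
    else C S h by [].
rewrite {}loadE; clearbody x.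
have [fits1|nfits1] := boolP (fits a b L (h :: t) S j (S h + a h));
  last have [fits2|nfits2] := boolP (fits a b L (h :: t) S j (C S h - L - a j)).
(* Joining moves the end of the last first task by a_j here and by b_h in attempt (ii); increasing
   [Q] by a_j + b_h covers both. *)
- rewrite fits1 in xE.
  have /and4P[_ _ _ clearb] := allP fits1 h (mem_head _ _).
  (* The second task of [j] cannot precede that of [h], so b_h <= a_j and the completion times stay
     ordered. *)
  have hx : S h + a h + L + b h <= S h + a h + a j + L.
    by case/orP: clearb => //; lra.
  rewrite /completion in le ss xE; rewrite xE.
  split=> //; first by lra.
  exists E, (Q + a j + b h); rewrite /completion.
  split; [lra|apply/andP; split; lra|lra|].
  by move=> i /ss [? ? ?]; split=> //; lra.
- rewrite (negPf nfits1) fits2 in xE.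
  have /and4P[cleara _ _ _] := allP fits2 h (mem_head _ _).
  rewrite /completion in le ss xE cleara; rewrite xE.
  have hx : S h + a h <= S h + a h + L + b h - L - a j.
    by case/orP: cleara => //; lra.
  split=> //; first by lra.
  exists E, (Q + a j + b h); rewrite /completion.
  split; [lra|apply/andP; split; lra|lra|].
  by move=> i /ss [? ? ?]; split=> //; lra.
- rewrite (negPf nfits1) (negPf nfits2) in xE.
  (* The delay L of the new block is paid by the slack Q + b_h kept in the block invariant together
     with one a_j. *)
  have QL : L <= Q + a j + b h.
    apply: (not_fits_block Q0 _ ss nfits1 nfits2).
    by rewrite Eh.
  rewrite /completion in le ss xE; rewrite xE; split; first by lra.
    apply/allP => i /ss [? ? _]; have := a_gt0 i; have := b_gt0 i.
    by move=> ? ?; rewrite /clear; apply/and4P; split; apply/orP; right; lra.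
  (* The new block contains only [j]: [E] is the end of its first task, and all earlier jobs are
     complete by then. *)
  exists (S h + a h + L + b h + a j), 0; rewrite /completion.
  split=> //; [apply/andP; split; lra|lra|].
  move=> i /ss [? ? _]; split; [lra|lra|left; lra].
Qed.

Lemma alg2_foldl_inv order st : uniq (rev order ++ st.1) -> alg2_inv st ->
  let st' := foldl (alg2_step a b L) st order in
  st'.1 = rev order ++ st.1 /\ alg2_inv st'.
Proof.
elim: order st => [|j s IHs] st //=.
rewrite rev_cons cat_rcons => uniqs invst; apply: (IHs (alg2_step a b L st j)).
  by [].
apply: alg2_step_inv => //.
by move: uniqs; rewrite cat_uniq /= => /and3P[_ _ /andP[]].
Qed.

Lemma alg2_inv_final order : sorted_order a b order ->
  alg2_inv (rev order, alg2 a b L order).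
Proof.
move=> /andP[perm_order _].
have uniq_order : uniq (rev order ++ [::]).
  by rewrite cats0 rev_uniq (perm_uniq perm_order) enum_uniq.
have inv0 : alg2_inv ([::], fun=> 0) by split; rewrite //= big_nil mulr0 addr0.
have [/= st1 invst] := @alg2_foldl_inv order (_, _) uniq_order inv0.
by move: st1 invst; rewrite /alg2 cats0; case: (foldl _ _ _) => ? ? /= ->.
Qed.

Lemma alg2_feasible order : sorted_order a b order ->
  feasible a b (fun=> L) (alg2 a b L order).
Proof.
have L0 := L_ge0; move=> ord; have [/= S0 sepS _ _] := alg2_inv_final ord.
have mems i : i \in rev order.
  by rewrite mem_rev (perm_mem (andP ord).1) mem_enum.
split=> [j|u v uv]; first exact: S0.
have len0 w : 0 < task_length a b w by rewrite /task_length; case: ifP.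
apply/(clearP _ _ (len0 u) (len0 v)).
case: u v uv => [i c] [k d]; rewrite xpair_eqE /task_start /task_length /=.
have [<-|ik _] := eqVneq i k.
  have := a_gt0 i; have := b_gt0 i; rewrite /clear.
  by case: c; case: d => //= ? ? _; apply/orP; [right|left]; lra.
have /and4P[] := sepS k i (mems k) (mems i) (contra_neq (@esym _ _ _) ik).
by case: c; case: d.
Qed.

Lemma alg2_total order S :
  sorted_order a b order -> feasible a b (fun=> L) S ->
  total_completion a b (fun=> L) (alg2 a b L order)
    <= 3 * total_completion a b (fun=> L) S.
Proof.
have L0 := L_ge0; move=> ord Sf; have [/= _ _ _] := alg2_inv_final ord.
rewrite size_rev; have [perm_order _] := andP ord.
have perm_rev : perm_eq (rev order) (enum 'I_n) by rewrite perm_rev.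
rewrite (perm_big _ perm_rev) big_enum /= (perm_size perm_order) size_enum_ord.
have opt_load := optimum_ge Sf ord.
(* Every completion time includes a delay L; this accounts for the third unit of the ratio, the
   loads for the other two. *)
have opt_L : L *+ n <= total_completion a b (fun=> L) S.
  rewrite -[n in L *+ n]card_ord -sumr_const; apply: ler_sum => j _.
  by have := Sf.1 j; have := a_gt0 j; have := b_gt0 j; rewrite /completion /=;
    lra.
by rewrite /total_completion in opt_load opt_L *; lra.
Qed.

End Approximation.

Theorem theorem7 :
  (* polynomial running time *)
  (exists p : {poly nat},
     forall (n : nat) (a b : 'I_n -> rat) (L : rat),
       (forall j, 0 < a j) -> (forall j, 0 < b j) -> 0 <= L ->
     exists (t : nat) (m : memory) (order : seq 'I_n),
       [/\ exec alg2_prog (input a b L) t m,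
           (t <= p.[input_size a b L])%N,
           sorted_order a b order
         & forall j, output m j = alg2 a b L order j]) /\
  (* feasibility and approximation factor *)
  (forall (R : realFieldType) (n : nat) (a b : 'I_n -> R) (L : R),
     (forall j, 0 < a j) -> (forall j, 0 < b j) -> 0 <= L ->
   forall order : seq 'I_n, sorted_order a b order ->
     feasible a b (fun=> L) (alg2 a b L order) /\
     (forall S : 'I_n -> R, feasible a b (fun=> L) S ->
        total_completion a b (fun=> L) (alg2 a b L order)
          <= 3 * total_completion a b (fun=> L) S)).
Proof.
split; last first.
  move=> R n a b L a0 b0 L0 order ord; split; first exact: alg2_feasible.
  by move=> S; exact: alg2_total.
have [p run] := alg2_prog_polynomial.
by exists p => n a b L _ _ _; exact: run.
Qed.
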